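(* Let $\mathcal{H}$ be a real or complex Hilbert space, $\mathcal{F},\mathcal{G}$ proper nontrivial subspaces of $\mathcal{H}$, and let $\mathcal{U}\subseteq\mathcal{F}$ and $\mathcal{V}\subseteq\mathcal{G}$ be a pair of strictly nondegenerate principal invariant subspaces for the subspaces $\mathcal{F}$ and $\mathcal{G}$. Let $W\in\mathcal{B}(\mathcal{H})$ be a unitary operator extending the isometry in the polar decomposition of $P_{\mathcal{G}}P_{\mathcal{F}}$, i.e. a unitary operator with $P_{\mathcal{G}}P_{\mathcal{F}}=W\sqrt{P_{\mathcal{F}}P_{\mathcal{G}}P_{\mathcal{F}}}$ (so that $P_{\mathcal{F}}P_{\mathcal{G}}P_{\mathcal{F}}=W^*P_{\mathcal{G}}P_{\mathcal{F}}P_{\mathcal{G}}W$). Then $\mathcal{V}=W\mathcal{U}$ and $\mathcal{U}=W^*\mathcal{V}$, while the orthogonal projectors satisfy $$P_{\mathcal{V}}=WP_{\mathcal{U}}W^*=P_{\mathcal{G}}P_{\mathcal{U}}\big((P_{\mathcal{F}}P_{\mathcal{G}})|_{\mathcal{U}}\big)^{-1}P_{\mathcal{U}}P_{\mathcal{G}}$$ and $$P_{\mathcal{U}}=W^*P_{\mathcal{V}}W=P_{\mathcal{F}}P_{\mathcal{V}}\big((P_{\mathcal{G}}P_{\mathcal{F}})|_{\mathcal{V}}\big)^{-1}P_{\mathcal{V}}P_{\mathcal{F}}.$$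
   Context: A subspace means a closed linear manifold; nontrivial means different from $\{0\}$, proper means different from $\mathcal{H}$. $P_{\mathcal{S}}$ denotes the orthogonal projector onto a subspace $\mathcal{S}$. A pair of subspaces $\mathcal{U}\subseteq\mathcal{F}$ and $\mathcal{V}\subseteq\mathcal{G}$ is called a pair of principal invariant subspaces for $\mathcal{F}$ and $\mathcal{G}$ if $P_{\mathcal{F}}\mathcal{V}\subseteq\mathcal{U}$ and $P_{\mathcal{G}}\mathcal{U}\subseteq\mathcal{V}$; it is strictly nondegenerate if $P_{\mathcal{F}}\mathcal{V}=\mathcal{U}\ne\{0\}$ and $P_{\mathcal{G}}\mathcal{U}=\mathcal{V}\ne\{0\}$. In this case the restrictions $(P_{\mathcal{F}}P_{\mathcal{G}})|_{\mathcal{U}}:\mathcal{U}\to\mathcal{U}$ and $(P_{\mathcal{G}}P_{\mathcal{F}})|_{\mathcal{V}}:\mathcal{V}\to\mathcal{V}$ have bounded inverses, which are the inverses appearing in the formulas. *)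

(* Defs.v *)
From HB Require Import structures.
From mathcomp Require Import all_boot all_order all_algebra.
From mathcomp Require Import complex.
From mathcomp Require Import boolp classical_sets functions reals topology.
From mathcomp Require Import normedtype.

Set Implicit Arguments.
Unset Strict Implicit.
Unset Printing Implicit Defensive.

Import Order.TTheory GRing.Theory Num.Theory.

Local Open Scope classical_set_scope.
Local Open Scope ring_scope.

Variant scalar_kind := RealScalars | ComplexScalars.

Definition scalars (R : realType) (k : scalar_kind) : numFieldType :=
  match k with
  | RealScalars => R
  | ComplexScalars => complex R
  end.

Definition scalar_conj (R : realType) (k : scalar_kind) :
    {rmorphism scalars R k -> scalars R k} :=
  match k return {rmorphism scalars R k -> scalars R k} with
  | RealScalars => idfun
  | ComplexScalars => @Num.conj (complex R)
  end.

(* A Hilbert space is a complete normed module H together with a positive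
   definite form dot such that dot x x = `|x| ^+ 2.  The form is linear in its
   first argument and conjugate-linear in its second one. *)
Section HilbertSpace.
Variables (R : realType) (k : scalar_kind).
Local Notation K := (scalars R k).
Variables (H : completeNormedModType K) (dot : {dot H for scalar_conj R k}).
Implicit Types (S F G U V : set H) (T A W : H -> H).

Definition hilbert_norm := forall x : H, dot x x = `|x| ^+ 2.

Definition closed_subspace S := closed S /\ submod_closed [in S].

Definition nontrivial_subspace S := S <> [set 0].

Definition proper_subspace S := S <> setT.

(* The value at x is the unique y in S such that x - y is orthogonal to S; it
   exists by the projection theorem when S is a closed subspace. *)
Definition orthproj S (x : H) : H :=
  xget 0 [set y | S y /\ forall z, S z -> dot (x - y) z = 0].

Definition bounded_op T :=
  linear T /\ exists M : K, forall x, `|T x| <= M * `|x|.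

(* The value is well defined for T in B(H), by the Riesz representation
   theorem. *)
Definition adjoint T (y : H) : H :=
  xget 0 [set z | forall x, dot (T x) y = dot x z].

Definition unitary W :=
  [/\ bounded_op W, adjoint W \o W = idfun & W \o adjoint W = idfun].

Definition positive_op T :=
  [/\ bounded_op T, adjoint T = T & forall x, 0 <= dot (T x) x].

(* The unique positive square root, which exists when T is positive. *)
Definition op_sqrt T : H -> H :=
  xget (fun=> 0) [set A | positive_op A /\ A \o A = T].

Definition principal_invariant F G U V :=
  [/\ closed_subspace U, closed_subspace V, U `<=` F & V `<=` G] /\
  (orthproj F @` V `<=` U /\ orthproj G @` U `<=` V).

Definition strictly_nondegenerate F G U V :=
  [/\ principal_invariant F G U V,
      orthproj F @` V = U, nontrivial_subspace U,
      orthproj G @` U = V & nontrivial_subspace V].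

(* For T mapping U bijectively onto U, this agrees on U with the inverse of
   the restriction of T to U. *)
Definition restr_inv T U : H -> H := 'pinv_(fun=> 0) U T.

End HilbertSpace.

(* Main.v *)
Require Import Defs.
From HB Require Import structures.
From mathcomp Require Import all_boot all_order all_algebra.
From mathcomp Require Import complex.
From mathcomp Require Import boolp classical_sets functions reals topology.
From mathcomp Require Import normedtype.
From mathcomp Require Import ring lra.

(** The isometry in the polar decomposition carries U onto V as soon as the
    square root A of T = P_F P_G P_F maps U onto itself, because then
    V = P_G U = P_G P_F U = W A U = W U ([polar_image]).  Strict nondegeneracy
    says T U = U.  As T is symmetric, P_U commutes with T = A^2, and a
    positive operator commutes with every orthogonal projector that commutes
    with its square ([nonneg_commutes_orthproj]): the reflection J = 2 P_U - 1
    commutes with A^2, so J A J is another positive square root of A^2 and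
    equals A by uniqueness.  Hence A U is contained in U, and
    U = A (A U) gives the other inclusion ([sqrt_image]).

    Uniqueness of the positive square root ([square_root_unique]) has an
    elementary proof.  If A^2 = C^2 with A, C >= 0, then D = A - C
    anticommutes with S = A + C.  From |Dx|^2 <= M |x|^2 for all x this yields
    |Dx|^2 <= (1/M + 1/kappa)^-1 |x|^2, with kappa depending only on the norms
    of A and C; iterating, |Dx|^2 <= (kappa / n) |x|^2 for every n, so D = 0.

    The value V = W U turns P_V = W P_U W* into the fact that unitaries
    preserve orthogonality ([orthproj_unitary_image]).  For the other formula
    ([orthproj_principal]), put w = (P_F P_G)|_U^-1 P_U P_G x.  Then P_G w lies
    in V, and x - P_G w is orthogonal to each P_G u with u in U, because
    (x - P_G w, P_G u) = (P_U P_G x - P_F P_G w, u) = 0.  The formula for P_U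
    is the same statement with (F, U) and (G, V) exchanged.

    Every estimate concerns the real part of the inner product, which makes H
    a real Hilbert space with the same norm and, on subspaces stable under all
    scalars, the same orthogonality ([orthP]).  This treats real and complex
    scalars together.  Projectors exist by the projection theorem
    ([projection_theorem]).  The square root and the adjoints are chosen
    elements, with default value 0 where no element exists.  A root exists
    because the value 0 would make V = W 0 = {0}.  The adjoint equations for A
    and W hold at every vector because a default value 0 there would force
    A = 0 or make the vector itself 0, and then 0 solves the equation
    ([positive_op_nonneg], [unitary_adjointP]). *)

Set Implicit Arguments.
Unset Strict Implicit.
Unset Printing Implicit Defensive.
Import Order.TTheory GRing.Theory Num.Theory.
Local Open Scope classical_set_scope.
Local Open Scope ring_scope.

(** * Real part of the scalars *)

Definition re (R : realType) (k : scalar_kind) : scalars R k -> R :=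
  match k return scalars R k -> R with
  | RealScalars => id
  | ComplexScalars => @complex.Re R
  end.

Definition ofR (R : realType) (k : scalar_kind) : R -> scalars R k :=
  match k return R -> scalars R k with
  | RealScalars => id
  | ComplexScalars => fun r => complex.Complex r 0
  end.

Section Scalars.
Variables (R : realType) (k : scalar_kind).
Local Notation K := (scalars R k).
Implicit Types (c : K) (r : R).

Lemma reD c d : re (c + d) = re c + re d.
Proof. by move: c d; case: k => //= -[? ?] [? ?]. Qed.

Lemma reN c : re (- c) = - re c.
Proof. by move: c; case: k => //= -[? ?]. Qed.

Lemma re_ofRM r c : re (ofR k r * c) = r * re c.
Proof. by move: c; case: k => //= -[? ?] /=; rewrite mul0r subr0. Qed.

Lemma re_conj c : re (scalar_conj R k c) = re c.
Proof. by move: c; case: k => //= -[? ?]. Qed.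

Lemma re_conjM_eq0 c : re (scalar_conj R k c * c) = 0 -> c = 0.
Proof.
move: c; case: k => /= [c /eqP|[a b]]; first by rewrite mulf_eq0 orbb => /eqP.
move=> /= h.
have /eqP : a ^+ 2 + b ^+ 2 = 0 by rewrite -h /=; ring.
by rewrite paddr_eq0 ?sqr_ge0 // !sqrf_eq0 => /andP[/eqP-> /eqP->].
Qed.

Lemma re_ge0 c : 0 <= c -> 0 <= re c.
Proof. by move: c; case: k => //= -[a b]; rewrite lecE => /andP[]. Qed.

Lemma ofR_re c : 0 <= c -> ofR k (re c) = c.
Proof. by move: c; case: k => //= -[a b]; rewrite lecE /= => /andP[/eqP->]. Qed.

Lemma re_ofR r : re (ofR k r) = r.
Proof. by case: k. Qed.

Lemma re_sqr c : 0 <= c -> re (c ^+ 2) = re c ^+ 2.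
Proof. by move=> c0; rewrite expr2 -{1}(ofR_re c0) re_ofRM expr2. Qed.

Lemma le_re c d : c <= d -> re c <= re d.
Proof. by rewrite -subr_ge0 => /re_ge0; rewrite reD reN subr_ge0. Qed.

Lemma re_gt0 c : 0 < c -> 0 < re c.
Proof.
move: c; case: k => //= -[a b]; by rewrite ltcE => /andP[].
Qed.

Lemma ofR_lt r s : (ofR k r < ofR k s) = (r < s).
Proof. by case: k => //=; rewrite ltcE /= eqxx. Qed.

Lemma ofR_gt0 r : (0 < ofR k r) = (0 < r).
Proof. by case: k => //=; rewrite ltcE /= eqxx. Qed.
End Scalars.

Section HilbertSpace.
Variables (R : realType) (k : scalar_kind).
Local Notation K := (scalars R k).
Variables (H : completeNormedModType K) (dot : {dot H for scalar_conj R k}).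
Hypothesis hdot : hilbert_norm dot.
Implicit Types (x y z u v : H) (S : set H) (r : R).

(** * The real inner product *)

Definition rdot x y : R := re (dot x y).
Local Notation "<< x , y >>" := (rdot x y).

Lemma dotC x y : dot x y = scalar_conj R k (dot y x).
Proof. by rewrite hermC /= expr0 mul1r. Qed.

Lemma rdotC x y : << x, y >> = << y, x >>.
Proof. by rewrite /rdot dotC re_conj. Qed.

Lemma rdotDl x y z : << x + y, z >> = << x, z >> + << y, z >>.
Proof. by rewrite /rdot linearDl reD. Qed.

Lemma rdotNl x z : << - x, z >> = - << x, z >>.
Proof. by rewrite /rdot linearNl reN. Qed.

Lemma rdotZl r x z : << ofR k r *: x, z >> = r * << x, z >>.
Proof. by rewrite /rdot linearZl_LR re_ofRM. Qed.

Lemma rdotDr x y z : << z, x + y >> = << z, x >> + << z, y >>.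
Proof. by rewrite rdotC rdotDl !(rdotC z). Qed.

Lemma rdotNr x z : << z, - x >> = - << z, x >>.
Proof. by rewrite rdotC rdotNl rdotC. Qed.

Lemma rdotZr r x z : << z, ofR k r *: x >> = r * << z, x >>.
Proof. by rewrite rdotC rdotZl rdotC. Qed.

Lemma rdot0l z : << 0, z >> = 0.
Proof. by have := rdotDl 0 0 z; rewrite addr0 => h; lra. Qed.

Lemma rdot0r z : << z, 0 >> = 0.
Proof. by rewrite rdotC rdot0l. Qed.

Definition rdotE :=
  (rdotDl, rdotDr, rdotNl, rdotNr, rdotZl, rdotZr, rdot0l, rdot0r).

Lemma rdot_norm x : << x, x >> = re `|x| ^+ 2.
Proof. by rewrite /rdot hdot re_sqr. Qed.

Lemma rdot_ge0 x : 0 <= << x, x >>.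
Proof. by rewrite rdot_norm sqr_ge0. Qed.

Lemma rdot_eq0 x : << x, x >> = 0 -> x = 0.
Proof.
rewrite rdot_norm => /eqP; rewrite sqrf_eq0 => /eqP h.
apply/eqP; rewrite -normr_eq0 -[`|x|](@ofR_re R k) // h.
by case: k.
Qed.

(** Expand |(y,y) x - (x,y) y|^2 >= 0 and divide by (y,y). *)
Lemma cauchy_schwarz x y : << x, y >> ^+ 2 <= << x, x >> * << y, y >>.
Proof.
have [/eqP y0|yn0] := eqVneq << y, y >> 0.
  by move: (rdot_eq0 (eqP y0)) => ->; rewrite !rdotE mulr0 expr0n.
have yp : 0 < << y, y >> by rewrite lt_def yn0 rdot_ge0.
have := rdot_ge0 (ofR k << y, y >> *: x - ofR k << x, y >> *: y).
rewrite !rdotE (rdotC y x) => h.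
rewrite -subr_ge0 -(pmulr_rge0 _ yp).
by apply: le_trans h _; rewrite le_eqVlt; apply/orP; left; apply/eqP; ring.
Qed.

(** * Closed subspaces and the projection theorem *)

Lemma subspaceD S x y : closed_subspace S -> S x -> S y -> S (x + y).
Proof.
move=> [_ [_ h]] Sx Sy; have := h 1 x y; rewrite scale1r !inE; exact.
Qed.

Lemma subspaceZ S (c : K) x : closed_subspace S -> S x -> S (c *: x).
Proof.
by move=> [_ [S0 h]] Sx; have := h c x 0; rewrite addr0 !inE in S0 *; exact.
Qed.

Lemma subspace0 S : closed_subspace S -> S 0.
Proof. by move=> [_ [S0 _]]; rewrite inE in S0. Qed.

Lemma subspaceB S x y : closed_subspace S -> S x -> S y -> S (x - y).
Proof.
by move=> Sc Sx Sy; apply: subspaceD => //; rewrite -scaleN1r; apply: subspaceZ.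
Qed.

(** Testing the real part against the multiple (x, z) z of z recovers
    |(x, z)|^2, so no information is lost. *)
Lemma orthP S x : closed_subspace S ->
  (forall z, S z -> dot x z = 0) <-> (forall z, S z -> << x, z >> = 0).
Proof.
move=> Sc; split=> h z Sz; first by rewrite /rdot h //; case: k.
have := h _ (subspaceZ (dot x z) Sc Sz).
by rewrite rdotC /rdot linearZl_LR /= (dotC z) mulrC; apply: re_conjM_eq0.
Qed.

Lemma ball_rdot y r z : 0 < r ->
  ball y (ofR k r) z = (<< y - z, y - z >> < r ^+ 2) :> Prop.
Proof.
move=> r0; rewrite -ball_normE /ball_ /= rdot_norm.
rewrite ltr_sqr ?nnegrE; [|exact/re_ge0/normr_ge0|exact: ltW].
have /(@ofR_re R k) <- := normr_ge0 (y - z).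
by rewrite ofR_lt re_ofR.
Qed.

(** The points of S almost minimizing the distance to x form a Cauchy filter
    by the parallelogram identity.  Such a point w is almost orthogonal, in
    that (x - w, z)^2 <= e (z, z) when w is within e of minimizing the squared
    distance, and this passes to the limit. *)
Lemma projection_theorem S x : closed_subspace S ->
  exists2 y, S y & forall z, S z -> << x - y, z >> = 0.
Proof.
move=> Sc.
pose E := [set << x - z, x - z >> | z in S].
have infE : has_inf E.
  split; first by exists << x - 0, x - 0 >>; exists 0 => //; apply: subspace0.
  by exists 0 => _ [z _ <-]; apply: rdot_ge0.
pose d := inf E.
have dlb z : S z -> d <= << x - z, x - z >>.
  by move=> Sz; apply: ge_inf; [case: infE | exists z].
pose B e := [set z | S z /\ << x - z, x - z >> < d + e].
pose Fil := filter_from [set e : R | 0 < e] B.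
have FF : ProperFilter Fil.
  apply: filter_from_proper; last first.
    move=> e e0; have [_ [z Sz <-] zd] := inf_adherent e0 infE.
    by exists z.
  apply: filter_from_filter; first by exists 1; rewrite /= ltr01.
  move=> e f e0 f0; exists (Num.min e f); first by rewrite /= lt_min e0 f0.
  move=> z [Sz]; rewrite /= => h; split; split=> //; apply: (lt_le_trans h);
    by rewrite lerD2l ge_min lexx ?orbT.
(* The midpoint of z and w is in S, hence at squared distance at least d. *)
have Bpar e z w : B e z -> B e w -> << z - w, z - w >> <= 4 * e.
  move=> [Sz hz] [Sw hw].
  have := dlb _ (subspaceZ (ofR k 2^-1) Sc (subspaceD Sc Sz Sw)).
  move: hz hw; rewrite !rdotE (rdotC z w) (rdotC z x) (rdotC w x).
  by move=> h1 h2 h3; lra.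
have Fcauchy : cauchy Fil.
  apply: cauchy_exP => e e0.
  have re0 : 0 < re e by apply: re_gt0.
  pose f := re e ^+ 2 / 8.
  have f0 : 0 < f by rewrite divr_gt0 ?exprn_gt0.
  have [z Bz] := filter_ex (F := Fil) (ex_intro2 _ _ f f0 (fun _ => id)).
  exists z; exists f => // w Bw.
  rewrite -(ofR_re (ltW e0)) ball_rdot //.
  apply: (le_lt_trans (Bpar _ _ _ Bz Bw)); rewrite /f.
  by move: (exprn_gt0 2 re0); lra.
have /cvg_ex [y Fy] := @cauchy_cvg H Fil FF Fcauchy.
have near_y e f : 0 < e -> 0 < f -> exists z, B e z /\ << y - z, y - z >> < f ^+ 2.
  move=> e0 f0.
  have FBe : Fil (B e) by exists e.
  have Fball : Fil (ball y (ofR k f)).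
    by apply: Fy; apply: nbhsx_ballx; rewrite ofR_gt0.
  have [z [Bz yz]] := filter_ex (filterI FBe Fball).
  by exists z; split=> //; rewrite -ball_rdot.
have Sy : S y.
  case: (Sc) => Scl _; apply: Scl => C yC.
  have FB1 : Fil (B 1) by exists 1 => //=; rewrite ltr01.
  have [z [[Sz _] Cz]] := filter_ex (filterI FB1 (Fy _ yC)).
  by exists z.
exists y => // z Sz.
have [/eqP z0|zn0] := eqVneq << z, z >> 0.
  by rewrite (rdot_eq0 (eqP z0)) rdot0r.
have zp : 0 < << z, z >> by rewrite lt_def zn0 rdot_ge0.
apply/eqP; rewrite -sqrf_eq0 eq_le sqr_ge0 andbT.
apply/ler_addgt0Pl => e e0; rewrite addr0.
(* 4 e' (z, z) = e: the square of a sum of two terms is at most twice the sum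
   of their squares, each at most e' (z, z). *)
pose e' := e / (4 * << z, z >>).
have e'0 : 0 < e' by rewrite divr_gt0 ?mulr_gt0.
pose f := Num.sqrt e'.
have f2 : f ^+ 2 = e' by rewrite sqr_sqrtr // ltW.
have [w [[Sw xw]]] := near_y e' f e'0 (etrans (sqrtr_gt0 _) e'0).
rewrite f2 => yw.
set p := << x - w, z >>.
(* Moving w by (p / (z, z)) z lowers the squared distance by p^2 / (z, z),
   which cannot exceed e'. *)
have hp : p ^+ 2 <= e' * << z, z >>.
  have := dlb _ (subspaceD Sc Sw (subspaceZ (ofR k (p / << z, z >>)) Sc Sz)).
  rewrite opprD addrA /p; move: (x - w) xw => u xw.
  set p' := << u, z >>.
  rewrite !rdotE (rdotC z u) -/p' => h.
  rewrite -ler_pdivrMr //.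
  have -> : p' ^+ 2 / << z, z >> = p' / << z, z >> * p' by ring.
  have hh : p' / << z, z >> * << z, z >> = p' by rewrite divfK.
  by move: xw h; rewrite hh; lra.
have hq : << w - y, z >> ^+ 2 <= e' * << z, z >>.
  apply: le_trans (cauchy_schwarz _ _) _; rewrite ler_pM2r //.
  by rewrite -opprB !(rdotNl, rdotNr) opprK ltW.
have -> : << x - y, z >> = p + << w - y, z >>.
  by rewrite /p -rdotDl addrA subrK.
have -> : e = 4 * (e' * << z, z >>).
  by rewrite /e'; field.
have := sqr_ge0 (p - << w - y, z >>); move: hp hq; rewrite sqrrB sqrrD; lra.
Qed.

Lemma eq_rdot x y : (forall z, << x, z >> = << y, z >>) -> x = y.
Proof. by move=> h; apply/subr0_eq/rdot_eq0; rewrite rdotDl rdotNl h subrr. Qed.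

(** * Orthogonal projectors and linear maps *)

Lemma orthproj_spec S x : closed_subspace S ->
  S (orthproj dot S x) /\ forall z, S z -> << x - orthproj dot S x, z >> = 0.
Proof.
move=> Sc; have [y Sy yP] := projection_theorem x Sc.
rewrite /orthproj; set Q := [set y | _].
have [] : Q (xget 0 Q) by apply: xgetPex; exists y; split=> //; apply/orthP.
by move=> ? /(orthP _ Sc).
Qed.

Lemma orthproj_eq S x y : closed_subspace S -> S y ->
  (forall z, S z -> << x - y, z >> = 0) -> orthproj dot S x = y.
Proof.
move=> Sc Sy h; have [Sp hp] := orthproj_spec x Sc.
apply/subr0_eq/rdot_eq0; set p := orthproj _ _ _ in Sp hp *.
have Spy : S (p - y) by apply: subspaceB.
have := hp _ Spy; have := h _ Spy.
by rewrite !rdotE => *; lra.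
Qed.

Section Projector.
Variable S : set H.
Hypothesis Sc : closed_subspace S.
Local Notation P := (orthproj dot S).

Lemma orthproj_in x : S (P x).
Proof. by case: (orthproj_spec x Sc). Qed.

Lemma rdot_orthproj x z : S z -> << P x, z >> = << x, z >>.
Proof.
move=> Sz; case: (orthproj_spec x Sc) => _ /(_ _ Sz).
by rewrite !rdotE => ?; lra.
Qed.

Lemma orthproj_id x : S x -> P x = x.
Proof. by move=> Sx; apply: orthproj_eq => // z _; rewrite subrr rdot0l. Qed.

Lemma orthproj_linear : linear P.
Proof.
move=> c x y; apply: orthproj_eq => //.
  apply: subspaceD => //; last exact: orthproj_in.
  by apply: subspaceZ => //; apply: orthproj_in.
move=> z; move: z; apply/(orthP _ Sc) => z Sz.
have -> : c *: x + y - (c *: P x + P y) = c *: (x - P x) + (y - P y).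
  by rewrite scalerBr opprD addrACA.
rewrite linearDl /= linearZl_LR /=.
have h u : dot (u - P u) z = 0.
  by move: z Sz; apply/(orthP _ Sc); case: (orthproj_spec u Sc).
by rewrite !h mulr0 addr0.
Qed.

Lemma orthproj_sym x y : << P x, y >> = << x, P y >>.
Proof.
rewrite rdotC -(rdot_orthproj y (orthproj_in x)) rdotC.
exact: rdot_orthproj (orthproj_in y).
Qed.
End Projector.

Section LinearMap.
Variable T : H -> H.
Hypothesis Tlin : linear T.
Lemma linD x y : T (x + y) = T x + T y.
Proof. by have := Tlin 1 x y; rewrite !scale1r. Qed.

Lemma linB x y : T (x - y) = T x - T y.
Proof. by rewrite addrC -scaleN1r Tlin scaleN1r addrC. Qed.

Lemma lin0 : T 0 = 0.
Proof. by have := linB 0 0; rewrite !subrr. Qed.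

Lemma linZ (c : K) x : T (c *: x) = c *: T x.
Proof. by have := Tlin c x 0; rewrite lin0 !addr0. Qed.
End LinearMap.

(** * Positive operators *)

(** Symmetric operators with 0 <= A <= a for the order of quadratic forms: the
    bound that survives conjugation by a reflection with the same a. *)
Record nonneg_le (A : H -> H) (a : R) : Prop := NonnegLe {
  nonneg_lin : linear A;
  nonneg_sym : forall x y, << A x, y >> = << x, A y >>;
  nonneg_ge0 : forall x, 0 <= << A x, x >>;
  nonneg_ub : forall x, << A x, x >> <= a * << x, x >>}.

(** Positivity of A tested at x - a^-1 A x. *)
Lemma nonneg_sqr_le A a x : 0 < a -> nonneg_le A a ->
  << A x, A x >> <= a * << A x, x >>.
Proof.
move=> a0 [Al As A0 Aa].
have := A0 (x - ofR k a^-1 *: A x).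
rewrite (linB Al) (linZ Al) !rdotE (As (A x) x).
have := Aa (A x).
set q := << A x, A x >>; set r := << A (A x), A x >> => hub.
have : a^-1 * (a^-1 * r) <= a^-1 * q.
  by rewrite ler_pM2l ?invr_gt0 // ler_pdivrMl.
move=> h1 h2.
have : 0 <= << A x, x >> - a^-1 * q by lra.
by rewrite subr_ge0 ler_pdivrMl.
Qed.

(** With D = A - C and S = A + C, the relation SD = -DS makes (S D^2 x, x) at
    most 0.  If the bound M of D^2 is nearly attained at x, then D^2 x is
    close to M x, so (Sx, x) is close to 0, hence so is Dx, since
    |Dx|^2 <= 2 a (Sx, x).  The loss del = M |x|^2 - |Dx|^2 makes this
    quantitative and improves the bound M. *)
Lemma square_root_unique A C a : 0 < a -> nonneg_le A a -> nonneg_le C a ->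
  (forall x, A (A x) = C (C x)) -> forall x, A x = C x.
Proof.
move=> a0 An Cn eqAC.
have [Al As A0 Aa] := An; have [Cl Cs C0 Ca] := Cn.
pose D x := A x - C x; pose S x := A x + C x.
have Ds x y : << D x, y >> = << x, D y >> by rewrite /D !rdotE As Cs.
have DS x : S (D x) = - D (S x).
  rewrite /S /D (linB Al) (linB Cl) (linD Al) (linD Cl) !eqAC.
  by apply: eq_rdot => z; rewrite !rdotE; ring.
have q2 u v : << u + v, u + v >> <= 2 * << u, u >> + 2 * << v, v >>.
  by have := rdot_ge0 (u - v); rewrite !rdotE (rdotC v u); lra.
pose s x := << S x, x >>.
have s0 x : 0 <= s x by rewrite /s rdotDl addr_ge0.
have Dle x : << D x, D x >> <= 2 * a * s x.
  have := q2 (A x) (- C x); rewrite rdotNl rdotNr opprK.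
  have := nonneg_sqr_le x a0 An; have := nonneg_sqr_le x a0 Cn.
  rewrite -/(D x) /s /S rdotDl; lra.
have Sle x : << S x, S x >> <= 2 * a * s x.
  have := q2 (A x) (C x).
  have := nonneg_sqr_le x a0 An; have := nonneg_sqr_le x a0 Cn.
  rewrite /s /S (rdotDl _ _ x); lra.
have sle x : s x <= 2 * a * << x, x >>.
  by rewrite /s /S rdotDl; have := Aa x; have := Ca x; lra.
have sE x : s x = << S x, x >> by [].
have DE x : A x - C x = D x by [].
clearbody s; clearbody S; clearbody D.
(* One factor 2 a comes from Dle, the other from the bound sdel below. *)
pose kap := 4 * a ^+ 2.
have kap0 : 0 < kap by rewrite mulr_gt0 ?exprn_gt0.
(* From the bound M, the improved bound is kap M / (M + kap); its inverse is
   M^-1 + kap^-1, so the bounds are kap / 1, kap / 2, kap / 3, etc. *)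
have step (n : nat) x : n.+1%:R * << D x, D x >> <= kap * << x, x >>.
  elim: n x => [|n IH] x.
    rewrite mul1r; apply: le_trans (Dle x) _.
    have -> : kap * << x, x >> = 2 * a * (2 * a * << x, x >>) by rewrite /kap; ring.
    by rewrite ler_pM2l ?mulr_gt0.
  pose M := kap / n.+1%:R.
  have M0 : 0 < M by rewrite divr_gt0 ?ltr0Sn.
  have DM y : << D y, D y >> <= M * << y, y >>.
    by rewrite /M mulrAC ler_pdivlMr ?ltr0Sn // mulrC.
  pose e := D (D x) - ofR k M *: x.
  pose del := M * << x, x >> - << D x, D x >>.
  have del0 : 0 <= del by rewrite subr_ge0.
  have ele : << e, e >> <= M * del.
    have := DM (D x).
    rewrite /e !rdotE (rdotC x (D (D x))) (Ds (D x) x) /del; nra.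
  (* Positivity of S at D x, moved to x by anticommutation. *)
  have Ms : M * s x <= - << S x, e >>.
    have := s0 (D x); rewrite sE DS rdotNl Ds.
    have -> : D (D x) = e + ofR k M *: x by rewrite /e subrK.
    rewrite rdotDr rdotZr -sE; lra.
  have sdel : M * s x <= 2 * a * del.
    have [-> | sn0] := eqVneq (s x) 0.
      by rewrite mulr0 mulr_ge0 // mulr_ge0 // ltW.
    have sp : 0 < s x by rewrite lt_def sn0 s0.
    have cs : (M * s x) ^+ 2 <= (2 * a * s x) * (M * del).
      apply: (@le_trans _ _ (<< S x, e >> ^+ 2)).
        have Ms0 : 0 <= M * s x by rewrite mulr_ge0 // ltW.
        by rewrite -(sqrrN << S x, e >>) ler_sqr ?nnegrE // (le_trans Ms0).
      apply: le_trans (cauchy_schwarz _ _) _.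
      by apply: ler_pM => //; apply: rdot_ge0.
    rewrite -(ler_pM2l (mulr_gt0 M0 sp)).
    by apply: le_trans cs _; rewrite le_eqVlt; apply/orP; left; apply/eqP; ring.
  have : M * << D x, D x >> <= kap * del.
    have -> : kap * del = 2 * a * (2 * a * del) by rewrite /kap; ring.
    apply: le_trans (_ : M * (2 * a * s x) <= _); first by rewrite ler_pM2l.
    have -> : M * (2 * a * s x) = 2 * a * (M * s x) by ring.
    by rewrite ler_pM2l ?mulr_gt0.
  have nM : n.+1%:R * M = kap by rewrite /M mulrC divfK ?pnatr_eq0.
  move=> Mdel; rewrite -(ler_pM2l M0).
  have -> : M * (n.+2%:R * << D x, D x >>) = kap * << D x, D x >> + M * << D x, D x >>.
    by rewrite -nM -[n.+2]addn1 natrD; ring.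
  by move: Mdel; rewrite /del; lra.
move=> x; apply/subr0_eq/rdot_eq0; rewrite DE.
apply/eqP; rewrite eq_le rdot_ge0 andbT leNgt; apply/negP => Dx0.
have := archi_boundP (divr_ge0 (mulr_ge0 (ltW kap0) (rdot_ge0 x)) (ltW Dx0)).
set N := Num.bound _; rewrite ltr_pdivrMr // => h.
have := lt_le_trans h (ler_wpM2r (ltW Dx0) _) => /(_ N.+1%:R).
by rewrite ler_nat leqnSn => /(_ isT); rewrite ltNge step.
Qed.

(** A^2 maps S into itself and is symmetric, hence commutes with the projector
    and with the reflection J.  So J A J is a positive square root of A^2. *)
Lemma nonneg_commutes_orthproj A a S : 0 < a -> nonneg_le A a ->
  closed_subspace S -> (forall x, S x -> S (A (A x))) ->
  forall x, A (orthproj dot S x) = orthproj dot S (A x).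
Proof.
move=> a0 An Sc inv.
have [Al As A0 Aa] := An.
set P := orthproj dot S.
have Pl : linear P := orthproj_linear Sc.
have PA2 x : P (A (A x)) = A (A (P x)).
  apply: orthproj_eq => //; first exact: inv (orthproj_in Sc _).
  move=> z Sz; rewrite -(linB Al) -(linB Al) !As !rdotDl rdotNl.
  by rewrite /P (rdot_orthproj Sc _ (inv _ Sz)) subrr.
pose J x := P x + P x - x.
have Jl : linear J.
  move=> c x y; rewrite /J Pl !scalerBr !scalerDr !opprD.
  by apply: eq_rdot => z; rewrite !(rdotDl, rdotNl); ring.
have JJ x : J (J x) = x.
  have PP : P (P x) = P x := orthproj_id Sc (orthproj_in Sc x).
  have -> : J (J x) = (P (J x) + P (J x)) - J x by [].
  by rewrite {1 2}/J (linB Pl) (linD Pl) PP addrK /J opprB addrC subrK.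
have Js x y : << J x, y >> = << x, J y >>.
  by rewrite /J /P !rdotE !(orthproj_sym Sc).
have JA x : A x = J (A (J x)).
  apply: (@square_root_unique A (fun x => J (A (J x))) a a0 An) => {x} [|x].
    split=> [c x y|x y|x|x]; first by rewrite Jl Al Jl.
    - by rewrite Js As Js.
    - by rewrite Js.
    - by rewrite Js; apply: le_trans (Aa _) _; rewrite Js JJ.
  rewrite JJ {2}/J.
  have -> : A (A (P x + P x - x)) = J (A (A x)).
    by rewrite /J !(linB Al, linD Al) PA2.
  by rewrite JJ.
have AJ x : A (J x) = J (A x) by rewrite [in RHS]JA JJ.
move=> x; have := AJ x; rewrite /J (linB Al) (linD Al) => /addIr.
rewrite -!mulr2n -!scaler_nat; apply: scalerI.
by rewrite pnatr_eq0.
Qed.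

(** The equation adjoint A = A gives symmetry only at points having an adjoint
    vector, and A vanishes at the others.  If y has none, then neither has
    x + y for x having one, so A x = A (x + y) - A y = 0: A vanishes
    everywhere, and 0 is an adjoint vector of y after all. *)
Lemma positive_op_nonneg A : positive_op dot A -> exists2 a, 0 < a & nonneg_le A a.
Proof.
move=> [[Al [M AM]] Aadj Apos].
have Aspec y : forall x, dot (A x) y = dot x (A y).
  pose Q y := [set z | forall x, dot (A x) y = dot x z].
  have AQ z : (exists w, Q z w) -> Q z (A z).
    by move=> ex; rewrite -Aadj; exact: (xgetPex 0 ex).
  apply: (AQ y); apply: contrapT => nex.
  have A0 z : ~ (exists w, Q z w) -> A z = 0.
    by move=> n; rewrite -Aadj /adjoint xgetPN // => w Qw; apply: n; exists w.
  apply: (nex); exists 0 => x; rewrite linear0r.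
  suff -> : A x = 0 by rewrite linear0l.
  have [[w xw]|] := pselect (exists w, Q x w); last exact: A0.
  have : A (x + y) = 0.
    apply: A0 => -[w' xyw]; apply: nex; exists (w' - w) => u.
    by rewrite linearBr /= -(xw u) -(xyw u) linearDr addrC addKr.
  by rewrite (linD Al) (A0 _ nex) addr0.
pose a := re `|M| + 1.
have M0 : 0 <= re `|M| by apply/re_ge0/normr_ge0.
have a0 : 0 < a by rewrite /a; lra.
exists a => //; split=> // [x y|x|x]; first by rewrite /rdot Aspec.
  exact/re_ge0/Apos.
have nAx : re `|A x| <= a * re `|x|.
  have h : `|A x| <= `|M| * `|x|.
    have := AM x => AMx; rewrite -[`|x|]normr_id -normrM.
    by rewrite ger0_norm // (le_trans _ AMx).
  have := le_re h; rewrite -{1}(ofR_re (normr_ge0 M)) re_ofRM.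
  by have := re_ge0 (normr_ge0 x); rewrite /a mulrDl mul1r; lra.
rewrite -ler_sqr ?nnegrE ?re_ge0 //; last by rewrite mulr_ge0 ?rdot_ge0 // ltW.
apply: le_trans (cauchy_schwarz _ _) _.
rewrite exprMn [X in _ <= _ * X]expr2 mulrA ler_wpM2r ?rdot_ge0 //.
rewrite !rdot_norm -exprMn ler_sqr ?nnegrE ?mulr_ge0 ?re_ge0 //.
exact: ltW.
Qed.

(** * Unitary operators *)

(** If y has no adjoint vector, the default value gives y = W 0 = 0, for which
    0 is an adjoint vector. *)
Lemma unitary_adjointP W : unitary dot W ->
  forall x y, << W x, y >> = << x, adjoint dot W y >>.
Proof.
move=> [[Wl _] _ WWs] x y; rewrite /rdot.
pose Q := [set z | forall x, dot (W x) y = dot x z].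
suff ex : exists z, Q z by rewrite (xgetPex 0 ex).
apply: contrapT => nex; apply: (nex); exists 0 => z.
have Wy0 : adjoint dot W y = 0.
  by rewrite /adjoint xgetPN // => w Qw; apply: nex; exists w.
have -> : y = 0 by have := congr1 (@^~ y) WWs; rewrite /= Wy0 lin0.
by rewrite !linear0r.
Qed.

Lemma orthproj_unitary_image W S : closed_subspace S -> unitary dot W ->
  closed_subspace (W @` S) ->
  orthproj dot (W @` S) = W \o orthproj dot S \o adjoint dot W.
Proof.
move=> Sc Wu WSc; have Wadj := unitary_adjointP Wu.
have [[Wl _] WsW WWs] := Wu.
have WsWx x : adjoint dot W (W x) = x := congr1 (@^~ x) WsW.
apply/funext => x; apply: orthproj_eq => //=.
  by exists (orthproj dot S (adjoint dot W x)) => //; apply: orthproj_in.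
move=> _ [z Sz <-].
have {1}-> : x = W (adjoint dot W x) := esym (congr1 (@^~ x) WWs).
rewrite -(linB Wl) rdotC Wadj WsWx rdotC rdotDl rdotNl.
by rewrite rdot_orthproj // subrr.
Qed.

(** * Pairs of principal invariant subspaces *)

Section PrincipalPair.
Variables F G U V : set H.
Hypotheses (Fc : closed_subspace F) (Gc : closed_subspace G).
Hypotheses (Uc : closed_subspace U) (Vc : closed_subspace V).
Hypotheses (UF : U `<=` F).
Hypotheses (FV : orthproj dot F @` V = U) (GU : orthproj dot G @` U = V).
Local Notation P := (orthproj dot).

Lemma orthproj_principal :
  P V = P G \o P U \o restr_inv (P F \o P G) U \o P U \o P G.
Proof.
apply/funext => x /=; set y := P U (P G x).
have Uy : U y by apply: orthproj_in.
have surj : set_surj U U (P F \o P G).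
  by move=> z; rewrite -{1}FV -GU => -[_ [u Uu <-] <-]; exists u.
set w := restr_inv _ _ _.
have Uw : U w.
  have sub := @surjpinv_image_sub _ _ (fun=> 0) U _ _ surj.
  by apply: sub; exists y.
have Tw : P F (P G w) = y by apply: (surjpK (fun=> 0) surj); rewrite inE.
rewrite (orthproj_id Uc Uw); apply: orthproj_eq => //.
  by rewrite -GU; exists w.
move=> z; rewrite -{1}GU => -[u Uu <-].
have Gp v := orthproj_in Gc v.
rewrite rdotDl rdotNl -2!(orthproj_sym Gc) (orthproj_id Gc (Gp _)).
by rewrite -(rdot_orthproj Fc (P G w) (UF Uu)) Tw
  (rdot_orthproj Uc _ Uu) subrr.
Qed.

(** On U the operator A^2 is P_F P_G, which maps U onto U. *)
Lemma sqrt_image A a : 0 < a -> nonneg_le A a ->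
  A \o A = P F \o P G \o P F -> A @` U = U.
Proof.
move=> a0 An AA.
have AAx x : A (A x) = P F (P G (P F x)) := congr1 (@^~ x) AA.
have AAU x : U x -> A (A x) = P F (P G x).
  by move=> Ux; rewrite AAx (orthproj_id Fc (UF Ux)).
have inv x : U x -> U (A (A x)).
  by move=> Ux; rewrite AAU // -FV -GU; exists (P G x) => //; exists x.
have AU x : U x -> U (A x).
  move=> Ux; rewrite -[x](orthproj_id Uc Ux).
  by rewrite (nonneg_commutes_orthproj a0 An Uc inv); apply: orthproj_in.
apply/seteqP; split=> [_ [x Ux <-]|x]; first exact: AU.
rewrite -{1}FV -GU => -[_ [u Uu <-] <-]; exists (A u); first exact: AU.
exact: AAU.
Qed.

(** If there were no positive square root, its default value 0 would force
    V = P_G P_F U = 0. *)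
Lemma polar_image W : linear W -> nontrivial_subspace V ->
  P G \o P F = W \o op_sqrt dot (P F \o P G \o P F) -> V = W @` U.
Proof.
move=> Wl Vn0; set T := P F \o P G \o P F => polar.
have VE : V = (W \o op_sqrt dot T) @` U.
  rewrite -polar -GU; apply/seteqP; split=> _ [x Ux <-]; exists x => //=;
    by rewrite (orthproj_id Fc (UF Ux)).
pose Q := [set A | positive_op dot A /\ A \o A = T].
have [Ap AA] : Q (op_sqrt dot T).
  apply: xgetPex; apply: contrapT => nex; apply: Vn0.
  have sq0 : op_sqrt dot T = fun=> 0.
    by apply: xgetPN => A QA; apply: nex; exists A.
  rewrite VE sq0; apply/seteqP; split=> [_ [x _ <-] /=|x ->]; first exact: (lin0 Wl).
  by exists 0; [exact: subspace0 | exact: (lin0 Wl)].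
have [a a0 An] := positive_op_nonneg Ap.
by rewrite VE -image_comp (sqrt_image a0 An AA).
Qed.
End PrincipalPair.
End HilbertSpace.

(** * Polar decomposition and projectors onto principal subspaces *)

Theorem theorem3p5 (R : realType) (k : scalar_kind)
    (H : completeNormedModType (scalars R k))
    (dot : {dot H for scalar_conj R k}) (hdot : hilbert_norm dot)
    (F G U V : set H)
    (hF : [/\ closed_subspace F, nontrivial_subspace F & proper_subspace F])
    (hG : [/\ closed_subspace G, nontrivial_subspace G & proper_subspace G])
    (hUV : strictly_nondegenerate dot F G U V)
    (W : H -> H) (hW : unitary dot W)
    (hWpolar : orthproj dot G \o orthproj dot F =
       W \o op_sqrt dot (orthproj dot F \o orthproj dot G \o orthproj dot F)) :
  let P := orthproj dot in
  let Wstar := adjoint dot W in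
  [/\ V = W @` U,
      U = Wstar @` V,
      P V = W \o P U \o Wstar /\
      P V = P G \o P U \o restr_inv (P F \o P G) U \o P U \o P G
    & P U = Wstar \o P V \o W /\
      P U = P F \o P V \o restr_inv (P G \o P F) V \o P V \o P F].
Proof.
move=> P Wstar.
have [Fc _ _] := hF; have [Gc _ _] := hG.
have [[[Uc Vc UF VG] _] FV Un0 GU Vn0] := hUV.
have [[Wl _] WsW WWs] := hW.
have VWU : V = W @` U := polar_image hdot Fc Uc UF FV GU Wl Vn0 hWpolar.
have UWV : U = Wstar @` V.
  by rewrite VWU image_comp /Wstar WsW image_id.
have PV : P V = W \o P U \o Wstar.
  by move: Vc; rewrite VWU => WUc; apply: orthproj_unitary_image.
split=> //; split=> //.
- exact: orthproj_principal.
- have WsWx x : Wstar (W x) = x := congr1 (@^~ x) WsW.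
  by apply/funext => x; rewrite PV /= !WsWx.
- exact: orthproj_principal.
Qed.
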